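(* For $k=0,1,2,\ldots$ define $$F_k := \sum_{l=0}^k \binom{k}{l}^3 (-8)^l.$$ Then, for any positive integer $n$, the number $$\frac{1}{n} \sum_{k=0}^{n-1} (6k+5) (-1)^k F_k$$ is an odd integer. *)

(* Defs.v *)
From mathcomp Require Import all_boot all_order all_algebra.

Set Implicit Arguments.
Unset Strict Implicit.
Unset Printing Implicit Defensive.

Local Open Scope ring_scope.

Definition F (k : nat) : int :=
  \sum_(0 <= l < k.+1) ('C(k, l) ^ 3)%:Z * (-8) ^+ l.

(* Main.v *)
(** Write C for the binomial C(n, l). Creative telescoping (Zeilberger) gives
      6 (-1)^n \sum_(k < n) (6 k + 5) (-1)^k F_k
        = \sum_l C^3 (-8)^l (12 n^2 - 2 n + 4 l - 30 n l + 21 l^2).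
    Since l C(n, l) = n C(n - 1, l - 1), the right-hand side is n G for an
    integer G. Modulo 4 only l = 0 contributes to G, so G = 2 mod 4. Modulo 3,
    G is \sum_l C^2 (C + C(n - 1, l - 1)); adding to it the sum reversed by
    l <-> n - l turns the bracket into 3 C, so 3 divides G. Hence G = 6 m with
    m odd. *)
Require Import Defs.
From mathcomp Require Import all_boot all_order all_algebra.
From mathcomp Require Import ring zify.

Import GRing.Theory Num.Theory.

Local Open Scope ring_scope.

Definition summand_weight (n l : int) : int :=
  12 * n ^+ 2 - 2 * n + 4 * l - 30 * n * l + 21 * l ^+ 2.

Definition weighted_sum (n : nat) : int :=
  \sum_(0 <= l < n.+1) ('C(n, l) ^ 3)%:Z * (-8) ^+ l * summand_weight n%:Z l%:Z.

(* ['C(n, l - 1)], with value 0 at [l = 0]. *)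
Definition bin_pred (n l : nat) : nat := if l is l'.+1 then 'C(n, l') else 0.

(* The last factor was found by solving the telescoping equation for a
   quadratic polynomial in [l]. *)
Definition certificate (n l : nat) : int :=
  (-8) ^+ l * (bin_pred n l)%:Z ^+ 3 *
  (3 * l%:Z ^+ 2 - (3 * n.+1%:Z + 2) * l%:Z + 3 * n.+1%:Z ^+ 2 + 4 * n.+1%:Z).

Lemma PoszX (m k : nat) : (m ^ k)%:Z = m%:Z ^+ k.
Proof. by rewrite -!natz natrX. Qed.

Lemma binS_bin_pred (n l : nat) : 'C(n.+1, l) = ('C(n, l) + bin_pred n l)%N.
Proof. by case: l => [|l]; rewrite ?bin0 // binS. Qed.

Lemma mul_bin_pred (n l : nat) : (n.+1 * bin_pred n l = l * 'C(n.+1, l))%N.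
Proof. by case: l => [|l] /=; rewrite ?muln0 // mul_bin_diag. Qed.

Lemma certificate_telescopes (n l : nat) :
  ('C(n.+1, l) ^ 3)%:Z * (-8) ^+ l * summand_weight n.+1%:Z l%:Z
  + ('C(n, l) ^ 3)%:Z * (-8) ^+ l * summand_weight n%:Z l%:Z
  + 6 * (6 * n + 5)%:Z * (('C(n, l) ^ 3)%:Z * (-8) ^+ l)
  = certificate n l - certificate n l.+1.
Proof.
have Eb : n.+1%:Z * (bin_pred n l)%:Z = l%:Z * ('C(n.+1, l))%:Z.
  by rewrite -!PoszM mul_bin_pred.
have Ec := binS_bin_pred n l.
rewrite /certificate /summand_weight [bin_pred n l.+1]/= !PoszX.
move: Eb Ec; set b := bin_pred n l; set a := 'C(n, l); set c := 'C(n.+1, l).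
move=> Eb Ec.
have Ec' : c%:Z = a%:Z + b%:Z by rewrite Ec PoszD.
have Ea : n.+1%:Z * a%:Z = (n.+1%:Z - l%:Z) * c%:Z.
  by rewrite mulrBl -Eb Ec'; ring.
rewrite (exprS (-8) l).
have -> : l.+1%:Z = l%:Z + 1 by lia.
have -> : (6 * n + 5)%:Z = 6 * (n.+1%:Z) - 1 by lia.
have -> : n%:Z = n.+1%:Z - 1 by lia.
(* After scaling by [n.+1 ^ 3], every term is a polynomial multiple of [c ^ 3]. *)
have Nn0 : n.+1%:Z ^+ 3 != 0 by [].
apply: (mulfI Nn0).
move: (n.+1%:Z) (l%:Z) ((-8) ^+ l) a b c Ea Eb {Ec Ec' Nn0}.
move=> N L X a b c Ea Eb.
have Ea3 : N ^+ 3 * a%:Z ^+ 3 = (N - L) ^+ 3 * c%:Z ^+ 3.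
  by rewrite -!exprMn Ea.
have Eb3 : N ^+ 3 * b%:Z ^+ 3 = L ^+ 3 * c%:Z ^+ 3 by rewrite -!exprMn Eb.
pose P := 12 * N ^+ 2 - 2 * N + 4 * L - 30 * N * L + 21 * L ^+ 2.
(* The weight at [N - 1] is [P - 24 * N + 14 + 30 * L]; adding [6 * (6 * N - 1)] gives the factor of
   [a ^ 3]. *)
transitivity (X * ((N ^+ 3 * c%:Z ^+ 3) * P
    + (N ^+ 3 * a%:Z ^+ 3) * (P + 12 * N + 8 + 30 * L))).
  by rewrite /P; ring.
pose B (j : int) := 3 * j ^+ 2 - (3 * N + 2) * j + 3 * N ^+ 2 + 4 * N.
transitivity (X * ((N ^+ 3 * b%:Z ^+ 3) * B L
    + 8 * (N ^+ 3 * a%:Z ^+ 3) * B (L + 1))).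
  by rewrite Ea3 Eb3 /P /B; ring.
by rewrite /B; ring.
Qed.

(** Summing [certificate_telescopes] over [l <= n.+1] leaves two boundary values, which vanish
    because [bin_pred n 0] and ['C(n, n.+1)] are 0. *)
Lemma weighted_sumS (n : nat) :
  weighted_sum n.+1 + weighted_sum n + 6 * (6 * n + 5)%:Z * F n = 0.
Proof.
have extend (G : nat -> int) :
    \sum_(0 <= l < n.+1) ('C(n, l) ^ 3)%:Z * G l =
    \sum_(0 <= l < n.+2) ('C(n, l) ^ 3)%:Z * G l.
  by rewrite [RHS]big_nat_recr //= bin_small // mul0r addr0.
have -> : weighted_sum n = \sum_(0 <= l < n.+2)
    ('C(n, l) ^ 3)%:Z * (-8) ^+ l * summand_weight n%:Z l%:Z.
  rewrite /weighted_sum; under eq_bigr do rewrite -mulrA.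
  by rewrite extend; under eq_bigr do rewrite mulrA.
rewrite /F extend mulr_sumr -!big_split /=.
under eq_bigr do rewrite certificate_telescopes -opprB.
rewrite sumrN telescope_sumr // /certificate /= bin_small //.
by rewrite !(expr0n, mulr0, mul0r) subrr oppr0.
Qed.

Lemma weighted_sumE (n : nat) :
  weighted_sum n
  = 6 * (-1) ^+ n * \sum_(0 <= k < n) (6 * k + 5)%:Z * (-1) ^+ k * F k.
Proof.
elim: n => [|n IHn].
  by rewrite /weighted_sum /summand_weight big_nat1 big_geq.
have := weighted_sumS n; rewrite IHn big_nat_recr //=.
set S := \sum_(0 <= k < n) _.
have : (-1) ^+ n * (-1) ^+ n = 1 :> int by rewrite -expr2 sqrr_sign.
rewrite exprS; move: ((-1) ^+ n) => e ee.
set W := weighted_sum _; set c := Posz _ => E.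
have -> : W = - (6 * e * S + 6 * c * F n).
  by apply/eqP; rewrite -subr_eq0 opprK addrA E.
(* The factor [e * e = 1] is inserted by hand so that the rest is a polynomial identity. *)
transitivity (- (6 * e * S + 6 * c * F n * (e * e))); first by rewrite ee mulr1.
by ring.
Qed.

(** The quotient of [weighted_sum n.+1] by [n.+1]: in the terms [4 * l + 21 * l ^ 2] of the weight,
    one [l] is absorbed by [mul_bin_pred]; the other terms already contain [n.+1]. *)
Definition cofactor (n : nat) : int :=
  \sum_(0 <= l < n.+2) ('C(n.+1, l) ^ 2)%:Z * (-8) ^+ l *
    ('C(n.+1, l)%:Z * (12 * n.+1%:Z - 2 - 30 * l%:Z)
     + (bin_pred n l)%:Z * (4 + 21 * l%:Z)).

Lemma weighted_sum_cofactor (n : nat) :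
  weighted_sum n.+1 = n.+1%:Z * cofactor n.
Proof.
rewrite /cofactor mulr_sumr; apply: eq_bigr => l _.
have : n.+1%:Z * (bin_pred n l)%:Z = l%:Z * ('C(n.+1, l))%:Z.
  by rewrite -!PoszM mul_bin_pred.
rewrite /summand_weight !PoszX.
move: (n.+1%:Z) (l%:Z) ((-8) ^+ l) ('C(n.+1, l)%:Z) ((bin_pred n l)%:Z).
move=> N L X c b Eb.
transitivity (c ^+ 2 * X * (c * N * (12 * N - 2 - 30 * L)
    + (N * b) * (4 + 21 * L))); last by ring.
by rewrite Eb; ring.
Qed.

Lemma cofactor_mod4 (n : nat) : (4 %| cofactor n - 2)%Z.
Proof.
rewrite /cofactor big_nat_recl // bin0 /= expr0 addrAC rpredD //.
  have -> : (1 ^ 2)%:Z * 1 * (1%:Z * (12 * n.+1%:Z - 2 - 30 * 0%:Z)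
      + 0%:Z * (4 + 21 * 0%:Z)) - 2 = (3 * n.+1%:Z - 1) * 4 :> int by ring.
  exact: dvdz_mull.
apply: rpred_sum => l _; apply: dvdz_mulr; apply: dvdz_mull.
by rewrite exprS dvdz_mulr.
Qed.

Lemma sum_bin_sqr_bin_pred (n : nat) :
  (2 * \sum_(0 <= l < n.+2) 'C(n.+1, l) ^ 2 * ('C(n.+1, l) + bin_pred n l)
   = 3 * \sum_(0 <= l < n.+2) 'C(n.+1, l) ^ 3)%N.
Proof.
rewrite mul2n -addnn {2}big_nat_rev -big_split big_distrr /=.
apply: eq_big_nat => l /andP[_ ltl]; rewrite add0n subSS.
have lel : (l <= n.+1)%N by [].
rewrite bin_sub //.
(* Symmetry of row [n]; at [l = n.+1] both sides are 0. *)
have -> : bin_pred n (n.+1 - l) = 'C(n, l).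
  move: lel; rewrite leq_eqVlt => /orP[/eqP->|lel].
    by rewrite subnn bin_small.
  by rewrite subSn //= bin_sub.
(* Pascal's rule merges ['C(n, l)] and [bin_pred n l] into a third copy of ['C(n.+1, l)]. *)
rewrite -mulnDr addnACA -(addnC 'C(n, l)) -binS_bin_pred expnS.
by lia.
Qed.

Lemma cofactor_mod3 (n : nat) : (3 %| cofactor n)%Z.
Proof.
have := sum_bin_sqr_bin_pred n; set H := (\sum_(0 <= l < _) _ * _)%N => EH.
(* By [EH], 3 divides [2 * H], hence [H]. *)
suff : (3 %| cofactor n - H%:Z)%Z by lia.
rewrite /cofactor /H (big_morph Posz PoszD (erefl _)) -sumrB.
apply: rpred_sum => l _; rewrite PoszM PoszD.
(* Modulo 3, [-8] and both linear factors of the summand are 1. *)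
have [e ->] : exists e : int, (-8) ^+ l = 1 + 3 * e.
  elim: l => [|l [e IHl]]; first by exists 0.
  by exists (- 3 - 8 * e); rewrite exprS IHl; ring.
rewrite PoszX; move: 'C(n.+1, l) (bin_pred n l) => c b.
have -> : c%:Z ^+ 2 * (1 + 3 * e) * (c%:Z * (12 * n.+1%:Z - 2 - 30 * l%:Z)
      + b%:Z * (4 + 21 * l%:Z)) - c%:Z ^+ 2 * (c%:Z + b%:Z)
    = c%:Z ^+ 2 * (c%:Z * (4 * n.+1%:Z - 1 - 10 * l%:Z) + b%:Z * (1 + 7 * l%:Z)
      + e * (c%:Z * (12 * n.+1%:Z - 2 - 30 * l%:Z)
             + b%:Z * (4 + 21 * l%:Z))) * 3 by ring.
exact: dvdz_mull.
Qed.

Theorem theorem1p3 (n : nat) (n_gt0 : (0 < n)%N) :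
  exists m : int,
    n%:R^-1 * (\sum_(0 <= k < n) (6 * k + 5)%:Z * (-1) ^+ k * F k)%:~R
      = m%:~R :> rat
    /\ odd `|m|%N.
Proof.
case: n n_gt0 => // n _.
have := weighted_sum_cofactor n; rewrite weighted_sumE.
set S := \sum_(0 <= k < _) _ => E.
have [m Em] : exists m, cofactor n = 6 * m.
  exists (cofactor n %/ 6)%Z.
  by have := cofactor_mod3 n; have := cofactor_mod4 n; lia.
have odd_m : odd `|m|%N by have := cofactor_mod4 n; lia.
(* The sign is the one in [weighted_sumE]; it does not affect parity. *)
exists ((-1) ^+ n.+1 * m); split; last by rewrite abszMsign.
have -> : S = n.+1%:Z * ((-1) ^+ n.+1 * m).
  apply: (mulfI (_ : 6 != 0 :> int)) => //.
  apply: (mulfI (_ : (-1) ^+ n.+1 != 0 :> int)); first by rewrite signr_eq0.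
  rewrite mulrA (mulrC _ 6) E Em.
  have := sqrr_sign int n.+1; move: ((-1) ^+ n.+1) => e ee.
  transitivity (n.+1%:Z * (6 * m) * (e ^+ 2)); first by rewrite ee mulr1.
  by ring.
by rewrite intrM mulrA mulVf ?mul1r // pnatr_eq0.
Qed.
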